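(* For each integer $N\geq 2$ let $\rho_N$ denote the unique positive real root of the polynomial $P_N(X)=X^N-X^{N-1}-\cdots-X-1$. Then the sequence $(\rho_N)_{N\geq 2}$ is monotonically increasing and converges to $2$. More precisely, for every $N\geq 2$, \[ 2-\frac{1}{2^{N-1}}<\rho_N<2-\frac{1}{2^{N}}<\rho_{N+1}<2-\frac{1}{2^{N+1}}, \] and in particular $|\rho_{N+1}-\rho_N|<\frac{1}{2^N}$.
   Context: It is known that $P_N$ has exactly one positive real root, and that it lies in the open interval $(1,2)$; this root is called the distinguished silver number of degree $N$. *)

(* Defs.v *)
From mathcomp Require Import all_boot all_order all_algebra.
From mathcomp Require Import all_classical all_reals all_analysis.

Set Implicit Arguments.
Unset Strict Implicit.
Unset Printing Implicit Defensive.

Import Order.TTheory GRing.Theory Num.Theory.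
Local Open Scope classical_set_scope.
Local Open Scope ring_scope.

Definition silver_poly (R : realType) (N : nat) : {poly R} :=
  'X^N - \sum_(i < N) 'X^i.

Definition positive_roots (R : realType) (p : {poly R}) : set R :=
  [set x | 0 < x /\ root p x].

(* [xget] picks an element of the set, with a junk value if there is none;
   [silver_number_unique] shows that for N >= 2 this is the one positive root. *)
Definition silver_number (R : realType) (N : nat) : R :=
  xget 0 (positive_roots (silver_poly R N)).

Lemma silver_poly_eval (R : realType) (N : nat) (x : R) :
  (silver_poly R N).[x] = x ^+ N - \sum_(i < N) x ^+ i.
Proof.
rewrite /silver_poly hornerD hornerN hornerXn horner_sum.
by congr (_ - _); apply: eq_bigr => i _; rewrite hornerXn.
Qed.

Lemma silver_poly_root_lt (R : realType) (N : nat) (x y : R) :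
  (0 < N)%N -> 0 < x -> x < y ->
  root (silver_poly R N) x -> ~~ root (silver_poly R N) y.
Proof.
move=> N0 x0 xy; rewrite /root !silver_poly_eval !subr_eq0 => /eqP Ex.
apply/negP => /eqP Ey.
have y0 : 0 < y by exact: lt_trans xy.
have: x ^+ N * \sum_(i < N) y ^+ i < y ^+ N * \sum_(i < N) x ^+ i.
  rewrite !mulr_sumr; apply: ltr_sum.
    by apply/hasP; exists (Ordinal N0); rewrite ?mem_index_enum.
  move=> [i /= iN] _; have d0 : (N - i != 0)%N by rewrite subn_eq0 -ltnNge.
  rewrite -(subnK (ltnW iN)) !exprD -!mulrA [y ^+ i * x ^+ i]mulrC.
  by rewrite ltr_pM2r ?mulr_gt0 ?exprn_gt0 // ltrXn2r // ltW.
by rewrite -Ex -Ey mulrC ltxx.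
Qed.

Lemma silver_number_unique (R : realType) (N : nat) : (2 <= N)%N ->
  1 < silver_number R N < 2 /\
  positive_roots (silver_poly R N) = [set silver_number R N].
Proof.
move=> N2; have N0 : (0 < N)%N by exact: ltnW.
have P1 : (silver_poly R N).[1] < 0.
  rewrite silver_poly_eval expr1n; under eq_bigr do rewrite expr1n.
  by rewrite sumr_const card_ord subr_lt0 ltr1n.
have P2 : (silver_poly R N).[2] = 1.
  have E : (2 : R) ^+ N - 1 = \sum_(i < N) 2 ^+ i.
    by rewrite subrX1 (_ : 2 - 1 = 1) ?mul1r // -[2]/(1 + 1) addrK.
  by rewrite silver_poly_eval -E opprB addrC subrK.
have [||x] := @poly_ivt R (silver_poly R N) 1 2.
- by rewrite ler1n.
- by rewrite P2 (ltW P1) ler01.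
move=> /andP[x1 x2] rx.
have x0 : 0 < x by exact: lt_le_trans x1.
have uniq y : 0 < y -> root (silver_poly R N) y -> y = x.
  move=> y0 ry; case: (ltgtP y x) => // h.
  - by have := silver_poly_root_lt N0 y0 h ry; rewrite rx.
  - by have := silver_poly_root_lt N0 x0 h rx; rewrite ry.
have Ex : silver_number R N = x.
  have [s0 rs] : positive_roots (silver_poly R N) (silver_number R N).
    exact: (@xgetPex _ 0 (positive_roots (silver_poly R N)) (ex_intro _ x (conj x0 rx))).
  exact: uniq.
rewrite Ex; split.
  rewrite !lt_neqAle x1 x2 !andbT; apply/andP; split; apply/eqP => E.
    by move: P1; rewrite E; move/rootP: rx => ->; rewrite ltxx.
  by move: P2; rewrite -E; move/rootP: rx => -> /esym/eqP; rewrite oner_eq0.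
by apply/seteqP; split => y /= => [[y0 ry]|->]; [exact: uniq|split].
Qed.

(* Main.v *)
(* Multiplying P_N by X - 1 telescopes it into 1 - X^N (2 - X), so that the
   positive root r of P_N satisfies r^N (2 - r) = 1.  Since r < 2, this gives
   2 - r > 1 / 2^N.  Conversely, if 1 < x < 2 and x^N (2 - x) > 1, then P_N is
   negative at x and positive at 2, so x < r; for x = 2 - c / 2^N Bernoulli's
   inequality makes this true with c = 2 for all N >= 2, and with c = 3/2 for
   N >= 3.  The bounds with c = 2 give monotonicity and the limit, but only
   bound the difference of consecutive roots by (3/2) / 2^N; the bound with
   c = 3/2 is what makes that difference less than 1 / 2^N for N >= 3, and
   N = 2 is settled numerically. *)
Require Import Defs.
From mathcomp Require Import all_boot all_order all_algebra.
From mathcomp Require Import all_classical all_reals all_analysis.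
From mathcomp Require Import ring lra zify.

Set Implicit Arguments.
Unset Strict Implicit.
Unset Printing Implicit Defensive.

Import Order.TTheory GRing.Theory Num.Theory.
Import numFieldNormedType.Exports.
Local Open Scope classical_set_scope.
Local Open Scope ring_scope.

(** Strictness matters: for N = 2 and c = 2 the last hypothesis of [silver_number_gt] is an
    equality, so the strict lower bound comes from here alone. In the induction, the discarded term
    is [m * e ^+ 2]. *)
Lemma bernoulli_strict (R : realFieldType) (e : R) (n : nat) :
  (2 <= n)%N -> 0 < e -> e < 1 -> 1 - n%:R * e < (1 - e) ^+ n.
Proof.
move=> n2 e0 e1; rewrite -(subnK n2) addnC.
elim: (n - 2)%N => [|k IH]; first by rewrite addn0 expr2; nra.
rewrite addnS exprS -natr1; set m := (2 + k)%:R : R in IH *.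
have m0 : 0 <= m by exact: ler0n.
have : (1 - e) * (1 - m * e) < (1 - e) * (1 - e) ^+ (2 + k).
  by rewrite ltr_pM2l // subr_gt0.
have : 0 <= m * e ^+ 2 by rewrite mulr_ge0 // sqr_ge0.
rewrite expr2; lra.
Qed.

Lemma mul_silver_poly (R : realType) (N : nat) (x : R) :
  (x - 1) * (silver_poly R N).[x] = 1 - x ^+ N * (2 - x).
Proof. by rewrite silver_poly_eval mulrBr -subrX1; ring. Qed.

Lemma silver_number_root (R : realType) (N : nat) : (2 <= N)%N ->
  silver_number R N ^+ N * (2 - silver_number R N) = 1.
Proof.
move=> N2; have [_ E] := silver_number_unique R N2.
have [_ /rootP r] : positive_roots (silver_poly R N) (silver_number R N).
  by rewrite E.
by have := mul_silver_poly N (silver_number R N); rewrite r; lra.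
Qed.

Lemma lt_silver_number (R : realType) (N : nat) (x : R) : (2 <= N)%N ->
  1 < x -> x < 2 -> 1 < x ^+ N * (2 - x) -> x < silver_number R N.
Proof.
move=> N2 x1 x2 hx; have [_ E] := silver_number_unique R N2.
have Px : (silver_poly R N).[x] < 0.
  by rewrite -(@pmulr_rlt0 _ (x - 1)) ?subr_gt0 // mul_silver_poly; lra.
have P2 : 0 <= (silver_poly R N).[2].
  by have := mul_silver_poly N (2 : R); rewrite subrr mulr0; lra.
have [||y /andP[xy _] ry] := @poly_ivt R (silver_poly R N) x 2.
- exact: ltW.
- by rewrite (ltW Px) P2.
have : positive_roots (silver_poly R N) y by split=> //; lra.
rewrite E /= => <-; rewrite lt_neqAle xy andbT; apply/eqP => xE.
by move: Px; rewrite xE (rootP ry) ltxx.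
Qed.

Lemma silver_number_lt (R : realType) (N : nat) : (2 <= N)%N ->
  silver_number R N < 2 - 1 / 2 ^+ N.
Proof.
move=> N2; have [/andP[r1 r2] _] := silver_number_unique R N2.
have := silver_number_root R N2; set r := silver_number R N in r1 r2 *.
have rN : r ^+ N < 2 ^+ N by rewrite ltrXn2r //; [lia|lra].
move=> rE; have d0 : 0 < 2 - r by lra.
have : 1 < 2 ^+ N * (2 - r) by rewrite -[ltLHS]rE ltr_pM2r.
rewrite mulrC -ltr_pdivrMr ?exprn_gt0 //; lra.
Qed.

(** Put e = c / 2^(N+1). The point x = 2 - c / 2^N is 2 (1 - e), so x^N (2 - x) = c (1 - e)^N, which
    Bernoulli makes larger than c (1 - N e). The bound on [c] keeps x above 1. *)
Lemma silver_number_gt (R : realType) (N : nat) (c : R) : (2 <= N)%N ->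
  0 < c -> c < 2 ^+ N -> 1 <= c * (1 - N%:R * (c / 2 / 2 ^+ N)) ->
  2 - c / 2 ^+ N < silver_number R N.
Proof.
move=> N2 c0 cN hc; set q : R := 2 ^+ N in cN hc *.
have q0 : 0 < q by rewrite exprn_gt0.
have u0 : 0 < c / q by rewrite divr_gt0.
have u1 : c / q < 1 by rewrite ltr_pdivrMr // mul1r.
apply: lt_silver_number => //; [lra|lra|].
have -> : 2 - c / q = 2 * (1 - c / 2 / q) by field; rewrite gt_eqF.
rewrite exprMn -/q.
have eE : c / 2 / q = c / q / 2 by field; rewrite gt_eqF.
have : 1 - N%:R * (c / 2 / q) < (1 - c / 2 / q) ^+ N.
  by apply: bernoulli_strict; rewrite ?eE //; lra.
set t := _ ^+ N => ht.
have -> : q * t * (2 - 2 * (1 - c / 2 / q)) = c * t by field; rewrite gt_eqF.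
by apply: le_lt_trans hc _; rewrite ltr_pM2l.
Qed.

(** This is the condition 2 (1 - n / 2^n) >= 1, for c = 2. *)
Lemma double_leq_exp2 (n : nat) : (2 * n <= 2 ^ n)%N.
Proof. by elim: n => [|[|n] IH] //; rewrite expnS; lia. Qed.

(** This is the condition (3/2) (1 - (3/4) n / 2^n) >= 1, for c = 3/2; it fails at n = 2. *)
Lemma leq_9n_exp2 (n : nat) : (3 <= n)%N -> (9 * n <= 4 * 2 ^ n)%N.
Proof.
move=> n3; rewrite -(subnK n3) addnC; elim: (n - 3)%N => [|k IH] //.
by rewrite addnS expnS; lia.
Qed.

Lemma silver_number_gt2 (R : realType) (N : nat) : (2 <= N)%N ->
  2 - 2 / 2 ^+ N < silver_number R N.
Proof.
move=> N2; have N0 : 0 < (2 : R) ^+ N by rewrite exprn_gt0.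
have h : 2 * N%:R <= (2 : R) ^+ N.
  by rewrite -natrX -natrM ler_nat double_leq_exp2.
have N2R : (2 : R) <= N%:R by rewrite ler_nat.
apply: silver_number_gt => //; first lra.
have : N%:R / (2 : R) ^+ N <= 1 / 2 by rewrite ler_pdivrMr //; lra.
rewrite divff // div1r; lra.
Qed.

Lemma silver_number_gt32 (R : realType) (N : nat) : (3 <= N)%N ->
  2 - (3 / 2) / 2 ^+ N < silver_number R N.
Proof.
move=> N3; have N0 : 0 < (2 : R) ^+ N by rewrite exprn_gt0.
have h : 9 * N%:R <= 4 * (2 : R) ^+ N.
  by rewrite -natrX -!natrM ler_nat leq_9n_exp2.
have N3R : (3 : R) <= N%:R by rewrite ler_nat.
apply: silver_number_gt; [exact: ltnW|lra|lra|].
have : N%:R / (2 : R) ^+ N <= 4 / 9 by rewrite ler_pdivrMr //; lra.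
lra.
Qed.

(** The constants 16/10 here and 185/100 in [silver_number3_lt] differ by exactly 1/4, the bound
    wanted for N = 2. *)
Lemma silver_number2_gt (R : realType) : 16 / 10 < silver_number R 2.
Proof. by apply: lt_silver_number => //; rewrite ?expr2; lra. Qed.

Lemma silver_number3_lt (R : realType) : silver_number R 3 < 185 / 100.
Proof.
have [/andP[r1 _] _] := @silver_number_unique R 3 isT.
have := silver_number_root R (isT : (2 <= 3)%N).
have := silver_number_lt R (isT : (2 <= 3)%N).
set r := silver_number R 3 in r1 * => r2 rE.
have r2' : r < 15 / 8 by move: r2; rewrite !exprS expr0; lra.
(* If r >= 185/100, then r^3 (2 - r) < (15/8)^3 (15/100) < 1, against [rE]. *)
rewrite ltNge; apply/negP => r3.
have : r ^+ 3 < (15 / 8) ^+ 3 by rewrite ltrXn2r //; lra.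
rewrite -(@ltr_pM2r _ (2 - r)) ?rE; last lra.
rewrite !exprS expr0; lra.
Qed.

Lemma silver_numberS_lt (R : realType) (N : nat) : (2 <= N)%N ->
  silver_number R N < silver_number R N.+1.
Proof.
(* The upper bound at N is the lower bound at N + 1, since 2 / 2^(N+1) = 1 / 2^N. *)
move=> N2; apply: lt_trans (silver_number_lt R N2) _.
have := @silver_number_gt2 R N.+1 (leqW N2).
by rewrite exprS invfM mulrA divff // div1r.
Qed.

Lemma silver_number_increasing (R : realType) (M N : nat) :
  (2 <= M)%N -> (M < N)%N -> silver_number R M < silver_number R N.
Proof.
move=> M2 MN; rewrite -(subnKC MN); elim: (N - M.+1)%N => [|k IH].
  by rewrite addn0; exact: silver_numberS_lt.
by rewrite addnS; apply: lt_trans IH _; apply: silver_numberS_lt; lia.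
Qed.

Lemma silver_number_cvg (R : realType) :
  silver_number R N @[N --> \oo] --> (2 : R).
Proof.
apply: (@squeeze_cvgr _ _ _ _ (fun N => 2 - 2 * (1 / 2) ^+ N) (fun=> 2)).
- near=> N; have N2 : (2 <= N)%N by near: N; exists 2%N.
  have [/andP[_ r2] _] := silver_number_unique R N2.
  have := silver_number_gt2 R N2.
  by rewrite expr_div_n expr1n div1r => /ltW ->; rewrite ltW.
- rewrite -[X in _ --> X]subr0 -[X in _ - X](mulr0 2).
  apply: cvgB; first exact: cvg_cst.
  apply: cvgM; first exact: cvg_cst.
  by apply: cvg_expr; rewrite ger0_norm; lra.
- exact: cvg_cst.
Unshelve. all: by end_near.
Qed.

Lemma silver_numberS_dist (R : realType) (N : nat) : (2 <= N)%N ->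
  `|silver_number R N.+1 - silver_number R N| < 1 / 2 ^+ N.
Proof.
move=> N2; rewrite gtr0_norm ?subr_gt0 ?silver_numberS_lt //.
move: N2; rewrite leq_eqVlt => /predU1P[<-|N3].
  have := silver_number2_gt R; have := silver_number3_lt R.
  rewrite expr2; lra.
(* The two bounds are 2 - (3/2) / 2^N and 2 - (1/2) / 2^N, exactly 1 / 2^N apart. *)
have := silver_number_gt32 R N3.
have := @silver_number_lt R N.+1 (leqW (ltnW N3)).
rewrite exprS invfM; lra.
Qed.

Theorem theorem2p8 (R : realType) :
  [/\ (forall M N : nat, (2 <= M)%N -> (M < N)%N ->
         silver_number R M < silver_number R N),
      silver_number R N @[N --> \oo] --> (2 : R),
      (forall N : nat, (2 <= N)%N ->
         [/\ 2 - 1 / 2 ^+ (N - 1) < silver_number R N,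
             silver_number R N < 2 - 1 / 2 ^+ N,
             2 - 1 / 2 ^+ N < silver_number R N.+1 &
             silver_number R N.+1 < 2 - 1 / 2 ^+ N.+1]) &
      (forall N : nat, (2 <= N)%N ->
         `|silver_number R N.+1 - silver_number R N| < 1 / 2 ^+ N)].
Proof.
(* Starting at 1 rather than 2 lets this serve both for the first bound, taken at N - 1, and for the
   third. *)
have lower N : (1 <= N)%N -> 2 - 1 / 2 ^+ N < silver_number R N.+1.
  move=> N1; have := @silver_number_gt2 R N.+1 N1.
  by rewrite exprS invfM mulrA divff // div1r.
split.
- exact: silver_number_increasing.
- exact: silver_number_cvg.
- move=> N N2; split.
  + by case: N N2 => // N N1; rewrite subn1; exact: lower.
  + exact: silver_number_lt.
  + exact/lower/ltnW.
  + exact/silver_number_lt/leqW.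
- exact: silver_numberS_dist.
Qed.
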